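(* For every $n>0$, the core label order $\mathrm{CLO}(\mathrm{Hoch}(n))$ of the Hochschild lattice $\mathrm{Hoch}(n)$ is a lattice.
   Context: Hochschild lattice. For $n\geq 1$, a triword of length $n$ is a tuple $u=(u_1,\ldots,u_n)$ such that (T1) $u_i\in\{0,1,2\}$ for all $i$; (T2) $u_1\neq 2$; (T3) if $u_i=0$, then $u_j\neq 1$ for all $j>i$. Let $\mathrm{Tri}(n)$ be the set of all triwords of length $n$. The Hochschild lattice is $\mathrm{Hoch}(n)=(\mathrm{Tri}(n),\leq)$ where $\leq$ is the componentwise order. It is known to be a semidistributive lattice: the join is the componentwise maximum, and the meet is obtained by taking the componentwise minimum and then replacing by $0$ every entry $1$ that has an entry $0$ somewhere to its left. Core label order. Let $L$ be a finite semidistributive lattice. For a cover relation $a\lessdot b$ put $\lambda(a,b)=\min\{c\in L\mid a\vee c=b\}$; this minimum exists and is join irreducible. The nucleus of $a\in L$ is $a_\downarrow=a\wedge\bigwedge_{b\lessdot a}b$. The core label set of $a$ is $\Psi(a)=\{\lambda(b,b')\mid a_\downarrow\leq b\lessdot b'\leq a\}$. The map $a\mapsto\Psi(a)$ is injective. The core label order $\mathrm{CLO}(L)$ is the poset $(L,\sqsubseteq)$ where $a\sqsubseteq b$ if and only if $\Psi(a)\subseteq\Psi(b)$. *)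

(* Defs.v *)
From HB Require Import structures.
From mathcomp Require Import all_boot all_order zify.

Set Implicit Arguments.
Unset Strict Implicit.
Unset Printing Implicit Defensive.

Import Order.TTheory.

Section OrderNotions.
Local Open Scope order_scope.

Definition is_glb (T : Type) (r : rel T) (x y m : T) : Prop :=
  [/\ r m x, r m y & forall z, r z x -> r z y -> r z m].

Definition is_lub (T : Type) (r : rel T) (x y j : T) : Prop :=
  [/\ r x j, r y j & forall z, r x z -> r y z -> r j z].

Definition is_poset (T : Type) (r : rel T) : Prop :=
  [/\ reflexive r, antisymmetric r & transitive r].

Definition is_lattice (T : Type) (r : rel T) : Prop :=
  [/\ is_poset r,
      forall x y, exists m, is_glb r x y m
    & forall x y, exists j, is_lub r x y j].

Definition covers d (T : finPOrderType d) (a b : T) : bool :=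
  (a < b) && [forall c, ~~ (a < c < b)].

Definition is_minimum d (T : finPOrderType d) (A : {set T}) (c : T) : bool :=
  (c \in A) && [forall x in A, c <= x].

Definition semidistributive d (L : latticeType d) : Prop :=
  (forall x y z : L, x `|` y = x `|` z -> x `|` (y `&` z) = x `|` y) /\
  (forall x y z : L, x `&` y = x `&` z -> x `&` (y `|` z) = x `&` y).

End OrderNotions.

(* The core label order makes sense when [L] is semidistributive: the minimum
   defining the label of a cover relation then exists ([edge_label_exists]). *)
Section CoreLabelOrder.
Local Open Scope order_scope.
Variables (d : Order.disp_t) (L : finTBLatticeType d).
Implicit Types a b c : L.

(* [edge_label a b c] means lambda(a, b) = c. *)
Definition edge_label a b c : bool :=
  is_minimum [set x | a `|` x == b] c.

Definition nucleus a : L := a `&` \meet_(b | covers b a) b.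

Definition core_labels a : {set L} :=
  [set c | [exists b, exists b',
     [&& nucleus a <= b, covers b b', b' <= a & edge_label b b' c]]].

(* This relation is antisymmetric only when [core_labels] is injective. *)
Definition core_label_le : rel L :=
  [rel a b | core_labels a \subset core_labels b].

Lemma edge_label_uniq a b c c' :
  edge_label a b c -> edge_label a b c' -> c = c'.
Proof.
move=> /andP[cA /forall_inP minc] /andP[c'A /forall_inP minc'].
by apply: le_anti; rewrite minc ?minc'.
Qed.

Lemma edge_label_exists a b :
  semidistributive L -> covers a b -> exists c, edge_label a b c.
Proof.
move=> [joinSD _] /andP[/ltW le_ab _].
exists (\meet_(x | a `|` x == b) x).
apply/andP; split; last first.
  by apply/forall_inP => x; rewrite inE => ax; apply: meets_inf.
have aUb : a `|` b = b by apply: join_r.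
have /meet_r <- : \meet_(x | a `|` x == b) x <= b by apply: meets_inf; apply/eqP.
rewrite inE.
elim/big_rec: _ => [|x y /eqP aUx /eqP aUby]; first by rewrite meetx1 aUb.
by rewrite meetCA joinSD aUx ?aUby.
Qed.

End CoreLabelOrder.

Section Triwords.
Variable n : nat.

(* Positions are numbered from 0, so that the first letter has index 0. *)
Definition is_triword (u : {ffun 'I_n -> 'I_3}) : bool :=
  [forall i : 'I_n, (i == 0 :> nat) ==> (u i != 2 :> nat)] &&
  [forall i : 'I_n, (u i == 0 :> nat) ==>
     [forall j : 'I_n, (i < j) ==> (u j != 1 :> nat)]].

Record triword := Triword {
  letters :> {ffun 'I_n -> 'I_3};
  _ : is_triword letters
}.

HB.instance Definition _ := [isSub for letters].
HB.instance Definition _ := [Finite of triword by <:].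

Implicit Types u v w : triword.

Definition triword_le u v : bool := [forall i, u i <= v i].

Definition letters_join u v : {ffun 'I_n -> 'I_3} :=
  [ffun i => Order.max (u i) (v i)].

Definition letters_min u v : {ffun 'I_n -> 'I_3} :=
  [ffun i => Order.min (u i) (v i)].

Definition letters_meet u v : {ffun 'I_n -> 'I_3} :=
  let m := letters_min u v in
  [ffun i => if (m i == 1 :> nat) && [exists j : 'I_n, (j < i) && (m j == 0 :> nat)]
             then ord0 else m i].

Lemma val_maxo (a b : 'I_3) : Order.max a b = maxn a b :> nat.
Proof. by rewrite /Order.max /maxn ltEord; case: ifP. Qed.

Lemma val_mino (a b : 'I_3) : Order.min a b = minn a b :> nat.
Proof. by rewrite /Order.min /minn ltEord; case: ifP. Qed.

Lemma triwordP (u : {ffun 'I_n -> 'I_3}) :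
  reflect ((forall i : 'I_n, i = 0 :> nat -> u i <> 2 :> nat) /\
           (forall i j : 'I_n, u i = 0 :> nat -> i < j -> u j <> 1 :> nat))
          (is_triword u).
Proof.
apply: (iffP andP) => [[/forallP T2 /forallP T3]|[T2 T3]]; split.
- by move=> i /eqP i0; apply/eqP/(implyP (T2 i)).
- move=> i j /eqP ui0 ij; apply/eqP; move/implyP: (T3 i) => /(_ ui0).
  by move/forallP/(_ j)/implyP/(_ ij).
- by apply/forallP => i; apply/implyP => /eqP i0; apply/eqP/T2.
- apply/forallP => i; apply/implyP => /eqP ui0; apply/forallP => j.
  by apply/implyP => ij; apply/eqP/(T3 i).
Qed.

Lemma triword_T2 u (i : 'I_n) : i = 0 :> nat -> u i <> 2 :> nat.
Proof. by case: u => u /= /triwordP[T2 _]; apply: T2. Qed.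

Lemma triword_T3 u (i j : 'I_n) : u i = 0 :> nat -> i < j -> u j <> 1 :> nat.
Proof. by case: u => u /= /triwordP[_ T3]; apply: T3. Qed.

Arguments triword_T2 u [i].
Arguments triword_T3 u [i j].

Lemma triword_leP u v : reflect (forall i, u i <= v i) (triword_le u v).
Proof. exact: forallP. Qed.

Lemma letters_join_subproof u v : is_triword (letters_join u v).
Proof.
apply/triwordP; split=> [i i0|i j]; rewrite !ffunE !val_maxo.
  by have := triword_T2 u i0; have := triword_T2 v i0; lia.
move=> m0 ij.
have [ui vi] : u i = 0 :> nat /\ v i = 0 :> nat by lia.
by have := triword_T3 u ui ij; have := triword_T3 v vi ij; lia.
Qed.

Variant meet_spec u v (i : 'I_n) : nat -> Prop :=
| MeetReset (j : 'I_n) of minn (u i) (v i) = 1 & j < i & minn (u j) (v j) = 0 :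
    meet_spec u v i 0
| MeetMin of (minn (u i) (v i) = 1 ->
                forall j : 'I_n, j < i -> minn (u j) (v j) <> 0) :
    meet_spec u v i (minn (u i) (v i)).

Lemma letters_meetP u v i : meet_spec u v i (letters_meet u v i).
Proof.
rewrite /letters_meet ffunE; case: ifPn => [/andP[/eqP]|].
  rewrite ffunE val_mino => m1 /existsP[j /andP[ji /eqP]].
  by rewrite ffunE val_mino => mj; apply: (MeetReset m1 ji mj).
rewrite ffunE val_mino => N; apply: MeetMin => m1 j ji mj.
case/negP: N; rewrite m1 eqxx; apply/existsP; exists j.
by rewrite ji ffunE val_mino mj.
Qed.

Lemma letters_meet_subproof u v : is_triword (letters_meet u v).
Proof.
apply/triwordP; split=> [i i0|i j].
  by case: letters_meetP => // _; have := triword_T2 u i0;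
     have := triword_T2 v i0; have := ltn_ord (u i); have := ltn_ord (v i); lia.
move=> mi0 ij; case: letters_meetP => // mj mj1.
case: letters_meetP mi0 => [k _ ki mk _ | _ mi0].
  exact: (mj mj1 k (ltn_trans ki ij) mk).
exact: (mj mj1 i ij mi0).
Qed.

Definition triword_join u v : triword := Triword (letters_join_subproof u v).
Definition triword_meet u v : triword := Triword (letters_meet_subproof u v).

Lemma triword_le_refl : reflexive triword_le.
Proof. by move=> u; apply/triword_leP. Qed.

Lemma triword_le_anti : antisymmetric triword_le.
Proof.
move=> u v /andP[/triword_leP uv /triword_leP vu].
apply/val_inj/ffunP => i; apply/val_inj/anti_leq.
by apply/andP; split; [apply: uv | apply: vu].
Qed.

Lemma triword_le_trans : transitive triword_le.
Proof.
move=> v u w /triword_leP uv /triword_leP vw; apply/triword_leP => i.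
exact: leq_trans (uv i) (vw i).
Qed.

Fact hochschild_display : Order.disp_t. Proof. exact: Order.Disp tt tt. Qed.

HB.instance Definition _ := Order.Le_isPOrder.Build hochschild_display triword
  triword_le_refl triword_le_anti triword_le_trans.

Lemma triword_meetP u v w :
  (u <= triword_meet v w)%O = (u <= v)%O && (u <= w)%O.
Proof.
apply/triword_leP/andP => [H | [/triword_leP uv /triword_leP uw] i].
  by split; apply/triword_leP => i; have := H i; rewrite /triword_meet /=;
     case: letters_meetP; lia.
rewrite /triword_meet /=; case: letters_meetP => [j mi ji mj | _]; last first.
  by have := uv i; have := uw i; lia.
have uj0 : u j = 0 :> nat by have := uv j; have := uw j; lia.
by have := triword_T3 u uj0 ji; have := uv i; have := uw i; lia.
Qed.

Lemma triword_joinP u v w :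
  (triword_join u v <= w)%O = (u <= w)%O && (v <= w)%O.
Proof.
apply/triword_leP/andP => [H | [/triword_leP uw /triword_leP vw] i].
  by split; apply/triword_leP => i; have := H i; rewrite ffunE val_maxo; lia.
by rewrite ffunE val_maxo geq_max uw vw.
Qed.

HB.instance Definition _ :=
  Order.POrder_isMeetSemilattice.Build hochschild_display triword triword_meetP.
HB.instance Definition _ :=
  Order.POrder_isJoinSemilattice.Build hochschild_display triword triword_joinP.

Definition letters_bottom : {ffun 'I_n -> 'I_3} := [ffun => ord0].
Definition letters_top : {ffun 'I_n -> 'I_3} :=
  [ffun i : 'I_n => if i == 0 :> nat then inord 1 else ord_max].

Lemma letters_bottom_subproof : is_triword letters_bottom.
Proof. by apply/triwordP; split=> [i _|i j _ _]; rewrite ffunE. Qed.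

Lemma letters_top_subproof : is_triword letters_top.
Proof.
apply/triwordP; split=> [i i0|i j]; rewrite ffunE; first by rewrite i0 /= inordK.
by case: ifP => //=; rewrite inordK.
Qed.

Definition triword_bottom : triword := Triword letters_bottom_subproof.
Definition triword_top : triword := Triword letters_top_subproof.

Lemma triword_le0x u : (triword_bottom <= u)%O.
Proof. by apply/triword_leP => i; rewrite ffunE. Qed.

Lemma triword_lex1 u : (u <= triword_top)%O.
Proof.
apply/triword_leP => i; rewrite ffunE; case: eqP => [i0|_] /=.
  by rewrite inordK //; have := triword_T2 u i0; have := ltn_ord (u i); lia.
by rewrite -ltnS ltn_ord.
Qed.

HB.instance Definition _ :=
  Order.hasBottom.Build hochschild_display triword triword_le0x.
HB.instance Definition _ :=
  Order.hasTop.Build hochschild_display triword triword_lex1.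

End Triwords.

Arguments triword_T2 [n] u [i].
Arguments triword_T3 [n] u [i j].

Definition Hoch (n : nat) : finTBLatticeType hochschild_display := triword n.

Section HochSemidistributive.
Variable n : nat.
Local Open Scope order_scope.
Implicit Types x y z w : Hoch n.

Lemma Hoch_leP x y : reflect (forall i, (x i <= y i)%N) (x <= y).
Proof. exact: triword_leP. Qed.

Lemma Hoch_joinE x y i : (x `|` y) i = maxn (x i) (y i) :> nat.
Proof. by rewrite /= ffunE val_maxo. Qed.

Lemma Hoch_meetP x y i : meet_spec x y i ((x `&` y) i).
Proof. exact: letters_meetP. Qed.

Lemma Hoch_joinSD x y z : x `|` y = x `|` z -> x `|` (y `&` z) = x `|` y.
Proof.
move=> E; have Ei i : maxn (x i) (y i) = maxn (x i) (z i).
  by rewrite -!Hoch_joinE E.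
apply: le_anti; rewrite leU2 ?leIl //=; apply/Hoch_leP => i.
rewrite !Hoch_joinE; case: Hoch_meetP => [j mi ji mj|_]; have := Ei i; last lia.
have [yz|yz] := eqVneq (val (y i)) (val (z i)); last by move: yz => /=; lia.
have y1 : y i = 1 :> nat by move: yz => /=; lia.
have z1 : z i = 1 :> nat by move: yz => /=; lia.
have [y0|z0] : y j = 0 :> nat \/ z j = 0 :> nat by lia.
  by have := triword_T3 y y0 ji.
by have := triword_T3 z z0 ji.
Qed.

Lemma Hoch_meetSD x y z : x `&` y = x `&` z -> x `&` (y `|` z) = x `&` y.
Proof.
move=> E; apply/le_anti/andP; split; last by rewrite leI2 ?leUl.
rewrite lexI leIl /=.
set w := x `&` (y `|` z).
have /Hoch_leP wx : w <= x by apply: leIl.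
have wyz i : (w i <= maxn (y i) (z i))%N.
  by rewrite -Hoch_joinE; move: i; apply/Hoch_leP; apply: leIr.
apply/Hoch_leP => i; rewrite leqNgt; apply/negP => yw.
have : ((x `&` z) i <= y i)%N by rewrite -E; move: i {yw}; apply/Hoch_leP; apply: leIr.
case: Hoch_meetP => [j mi ji mj _|_]; have := wx i; have := wyz i; last lia.
move=> wi1 wi2; have wi : w i = 1 :> nat by lia.
have wj (k : 'I_n) : (k < i)%N -> w k <> 0 :> nat.
  by move=> ki wk; apply: (triword_T3 w wk ki).
pose P (k : 'I_n) := (k < i)%N && ((x `&` y) k == 0 :> nat).
have pj : P j.
  by rewrite /P ji E; case: (Hoch_meetP x z j) => // _; apply/eqP.
case: (arg_minnP (fun k : 'I_n => k : nat) pj) => k /andP[ki /eqP pk] kmin.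
have pmin (l : 'I_n) : (l < k)%N -> (x `&` y) l <> 0 :> nat.
  move=> lk /eqP pl; have := kmin l; rewrite /P pl (ltn_trans lk ki) => /(_ isT).
  lia.
have aux v : x `&` v = x `&` y -> v k = 0 :> nat.
  move=> Ev; have := pk; rewrite -Ev; case: Hoch_meetP => [l _ lk ml _|_].
    case: (pmin l lk); rewrite -Ev; case: (Hoch_meetP x v l) => //.
  have := wx k; have := wj k ki; lia.
by have := aux y erefl; have := aux z (esym E); have := wyz k; have := wj k ki; lia.
Qed.

Lemma Hoch_semidistributive : semidistributive (Hoch n).
Proof. by split=> x y z; [apply: Hoch_joinSD | apply: Hoch_meetSD]. Qed.

End HochSemidistributive.

(* Main.v *)
(** The join irreducibles of [Hoch n] are the words [1^k 0^(n-k)] and the words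
    with a single nonzero letter [2].  The core label set of [u] consists of
    the single-[2] words below [u] at the positions where [u] has a [2],
    together with the words [1^(i+1) 0^(n-i-1)] such that [u] has no [0] up to
    position [i] and no [1] after it.  The intersection of two such sets is
    again the core label set of a triword, so meets exist; since there is a
    largest element, the join is the meet of all upper bounds. *)
Require Import Defs.
From mathcomp Require Import all_boot all_order.
From mathcomp Require Import zify.

Set Implicit Arguments.
Unset Strict Implicit.
Unset Printing Implicit Defensive.

Import Order.TTheory.

Section HochschildCoreLabels.
Variable n : nat.
Implicit Types u v w x y z c : Hoch n.
Implicit Types i j k : 'I_n.

(** * Triwords from letter functions, and the two families of join irreducibles *)

Lemma Hoch_eqP u v : (forall i, u i = v i :> nat) -> u = v.
Proof. by move=> uv; apply/val_inj/ffunP => i; apply/val_inj/uv. Qed.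

Lemma letter_lt3 u i : u i < 3.
Proof. exact: ltn_ord. Qed.

(** Allows a word to be specified by natural-number letters; it builds both the lower covers and the
    word realizing an intersection of label sets. *)
Lemma triword_ext (f : 'I_n -> nat) :
  (forall i, f i < 3) -> (forall i, i = 0 :> nat -> f i <> 2) ->
  (forall i j, f i = 0 -> i < j -> f j <> 1) ->
  exists w, forall i, w i = f i :> nat.
Proof.
move=> f3 T2 T3; pose g : {ffun 'I_n -> 'I_3} := [ffun i => inord (f i)].
have gE i : g i = f i :> nat by rewrite ffunE inordK.
have tri_g : is_triword g.
  by apply/triwordP; split=> [i|i j]; rewrite !gE; [apply: T2 | apply: T3].
by exists (Triword tri_g).
Qed.

Definition ones_letters (m : nat) : {ffun 'I_n -> 'I_3} :=
  [ffun j : 'I_n => inord (j < m)].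

Lemma ones_lettersE m j : ones_letters m j = (j < m) :> nat.
Proof. by rewrite ffunE inordK //; case: (j < m). Qed.

Lemma ones_subproof m : is_triword (ones_letters m).
Proof. by apply/triwordP; split=> [i|i j]; rewrite !ones_lettersE; lia. Qed.

Definition ones m : Hoch n := Triword (ones_subproof m).

Lemma onesE m j : ones m j = (j < m) :> nat.
Proof. exact: ones_lettersE. Qed.

Definition two_letters i : {ffun 'I_n -> 'I_3} :=
  [ffun j : 'I_n => inord (((0 < i) && (j == i)).*2)].

Lemma two_lettersE i j : two_letters i j = ((0 < i) && (j == i)).*2 :> nat.
Proof. by rewrite ffunE inordK //; case: (_ && _). Qed.

Lemma two_subproof i : is_triword (two_letters i).
Proof.
by apply/triwordP; split=> [j j0|j k]; rewrite !two_lettersE;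
   [case: eqP => [<-|]; rewrite ?j0 ?andbF | lia].
Qed.

(* For [i = 0] this is the bottom element. *)
Definition two i : Hoch n := Triword (two_subproof i).

Lemma twoE i j : two i j = ((0 < i) && (j == i)).*2 :> nat.
Proof. exact: two_lettersE. Qed.

Lemma two_pos u i : u i = 2 :> nat -> 0 < i.
Proof. by move=> ui; rewrite lt0n; apply/eqP => /(triword_T2 u). Qed.

Lemma two_diag u i : u i = 2 :> nat -> two i i = 2 :> nat.
Proof. by move=> /two_pos i0; rewrite twoE i0 eqxx. Qed.

Lemma le_two u i : u i = 2 :> nat -> (two i <= u)%O.
Proof.
move=> ui; apply/Hoch_leP => j; rewrite twoE; case: (eqVneq j i) => [->|_].
  by rewrite ui andbT; case: (0 < i).
by rewrite andbF.
Qed.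

Lemma le_ones u m : (forall j, j < m -> u j <> 0 :> nat) -> (ones m <= u)%O.
Proof. by move=> H; apply/Hoch_leP => j; rewrite onesE; have := H j; lia. Qed.

(** * Cover relations and their labels *)

Lemma covers_join w w' c :
  covers w w' -> (c <= w')%O -> ~~ (c <= w)%O -> (w `|` c)%O = w'.
Proof.
move=> /andP[ww' /forallP /(_ (w `|` c)%O)]; rewrite negb_and => N cw' cw.
apply/eqP; rewrite eq_le leUx (ltW ww') cw' /=.
move: N; rewrite lt_neqAle leUl andbT negbK => /orP[/eqP E|].
  by case/negP: cw; rewrite E leUr.
by rewrite lt_neqAle leUx (ltW ww') cw' !andbT negbK => /eqP ->.
Qed.

(** Joins are letterwise maxima, so a word whose join with [w] is [w'] must itself have the letter 2
    at [i], and [two i] is the least such word. *)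
Lemma edge_label_two w w' i :
  covers w w' -> w i <> 2 :> nat -> w' i = 2 :> nat -> edge_label w w' (two i).
Proof.
move=> ww' wi wi'; apply/andP; split.
  rewrite inE (covers_join ww' (le_two wi')) //.
  by apply/negP => /Hoch_leP/(_ i); rewrite (two_diag wi'); have := letter_lt3 w i; lia.
apply/forall_inP => c; rewrite inE => /eqP E; apply: le_two.
by move: wi'; rewrite -E Hoch_joinE; lia.
Qed.

(** As for [two i], but here the letter 1 at [i] excludes any earlier 0 by (T3), so [ones i.+1] is
    the least word with a 1 at [i]. *)
Lemma edge_label_ones w w' i :
  covers w w' -> w i = 0 :> nat -> w' i = 1 :> nat ->
  edge_label w w' (ones i.+1).
Proof.
have nz c : c i = 1 :> nat -> forall j, j < i.+1 -> c j <> 0 :> nat.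
  move=> ci j; rewrite ltnS leq_eqVlt => /orP[/eqP/val_inj ->|ji cj]; first by rewrite ci.
  exact: (triword_T3 c cj ji).
move=> ww' wi wi'; apply/andP; split.
  rewrite inE (covers_join ww' (le_ones (nz _ wi'))) //.
  by apply/negP => /Hoch_leP/(_ i); rewrite onesE wi ltnSn.
apply/forall_inP => c; rewrite inE => /eqP E; apply/le_ones/nz.
by move: wi'; rewrite -E Hoch_joinE; lia.
Qed.

(* A jump [0 -> 2] in one letter is a cover when an earlier [0] forbids the
   intermediate letter [1]. *)
Lemma covers_letter w w' i :
  (forall j, j != i -> w j = w' j :> nat) -> w i < w' i ->
  w' i = (w i).+1 :> nat \/ (exists2 k : 'I_n, k < i & w k = 0 :> nat) ->
  covers w w'.
Proof.
move=> same lt_i step; apply/andP; split.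
  rewrite lt_neqAle; apply/andP; split.
    by apply/eqP => E; move: lt_i; rewrite E ltnn.
  apply/Hoch_leP => j; have [->|/same ->//] := eqVneq j i; exact: ltnW.
apply/forallP => z; apply/negP => /andP[wz zw'].
have /Hoch_leP le_wz := ltW wz; have /Hoch_leP le_zw' := ltW zw'.
have zj j : j != i -> z j = w j :> nat.
  by move=> ji; have := same j ji; have := le_wz j; have := le_zw' j; lia.
have [zi|zi] := eqVneq (z i : nat) (w i).
  suff E : z = w by rewrite E ltxx in wz.
  by apply: Hoch_eqP => j; have [->//|/zj] := eqVneq j i.
have [zi'|zi'] := eqVneq (z i : nat) (w' i).
  suff E : z = w' by rewrite E ltxx in zw'.
  by apply: Hoch_eqP => j; have [->//|ji] := eqVneq j i; rewrite zj ?same.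
have := le_wz i; have := le_zw' i; have := letter_lt3 w' i.
case: step => [|[k ki wk]]; first by lia.
have zk : z k = 0 :> nat by rewrite zj // neq_ltn ki.
by have := triword_T3 z zk ki; lia.
Qed.

(** Only letter [i] is lowered. Lowering a 1 to 0 requires that no 1 follows, by (T3); a 2 can
    always be lowered. *)
Lemma lower_letter u i :
  u i <> 0 :> nat -> (u i = 2 :> nat \/ forall j, i < j -> u j <> 1 :> nat) ->
  exists2 w, covers w u & w i < u i.
Proof.
move=> ui0 ui; have ui3 := letter_lt3 u i.
pose zero_before := [exists k : 'I_n, (k < i) && (u k == 0 :> nat)].
(* A 1 drops to 0. A 2 drops to 1, unless an earlier 0 forbids the letter 1; then it drops directly
   to 0. *)
pose low : nat := (u i == 2 :> nat) && ~~ zero_before.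
pose f j : nat := if j == i then low else u j.
have low_lt : low < u i by rewrite /low; case: eqP => [->|_]; [case: (~~ _) | lia].
have low1 : low <= 1 by rewrite /low; case: (_ && _).
have [||j k|w wE] := @triword_ext f.
- by move=> j; rewrite /f; case: ifP => _; [lia | apply: letter_lt3].
- by move=> j j0; rewrite /f; case: ifP => _; [lia | apply: triword_T2].
- rewrite /f; have [->|_] := eqVneq j i.
    move=> low0 ik; rewrite -val_eqE gtn_eqF //=.
    case: ui => [ui2|]; last by apply.
    move: low0; rewrite /low /zero_before ui2; case: existsP => // -[h /andP[hi /eqP uh]] _.
    exact: (triword_T3 u uh (ltn_trans hi ik)).
  have [->|_] := eqVneq k i; last exact: triword_T3.
  move=> uj ji; rewrite /low; suff -> : zero_before by rewrite andbF.
  by apply/existsP; exists j; rewrite ji uj.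
exists w; last by rewrite wE /f eqxx.
have same j : j != i -> w j = u j :> nat by rewrite wE /f => /negbTE ->.
have wi : w i = low :> nat by rewrite wE /f eqxx.
apply: (covers_letter same); rewrite wi // /low /zero_before.
case: eqP => [ui2|]; last by move=> ?; left => /=; lia.
case: existsP => [[k /andP[ki /eqP uk]]|_]; last by left; rewrite ui2.
by right; exists k; rewrite ?same // neq_ltn ki.
Qed.

(** * The nucleus and the description of core label sets *)

Definition ones_label u i : bool :=
  [forall j : 'I_n, if j <= i then u j != 0 :> nat else u j != 1 :> nat].

Lemma ones_labelP u i :
  reflect ((forall j, j <= i -> u j <> 0 :> nat) /\
           (forall j, i < j -> u j <> 1 :> nat)) (ones_label u i).
Proof.
apply: (iffP forallP) => [H|[le_i gt_i] j].
  by split=> j ij; have := H j; [rewrite ij | rewrite leqNgt ij] => /eqP.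
by case: leqP => ji; apply/eqP; [apply: le_i | apply: gt_i].
Qed.

Lemma last_one u i :
  u i = 1 :> nat -> exists2 l : 'I_n, i <= l & u l = 1 :> nat /\ ones_label u l.
Proof.
move=> /eqP ui.
case: (@arg_maxnP _ i (fun j => u j == 1 :> nat) (fun j => j : nat) ui) => l /eqP ul maxl.
exists l; first exact: maxl.
split=> //; apply/ones_labelP; split=> j; last first.
  by move=> lj /eqP /maxl /=; lia.
rewrite leq_eqVlt => /orP[/eqP/val_inj ->|jl uj]; first by rewrite ul.
exact: (triword_T3 u uj jl).
Qed.

Lemma nucleus_le u : (nucleus u <= u)%O.
Proof. exact: leIl. Qed.

Lemma nucleus_le_cover u w : covers w u -> (nucleus u <= w)%O.
Proof. by move=> wu; apply: le_trans (leIr _ _) _; apply: meets_inf. Qed.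

(** A lower cover [b] of [u] not above [ones i.+1] would have join [u] with it. As [i < j], the 1 at
    [j] then comes from [b], and (T3) leaves [b] no 0 before [j], which puts [ones i.+1] below [b]
    after all. *)
Lemma ones_le_nucleus u i j :
  i < j -> u j = 1 :> nat -> (ones i.+1 <= nucleus u)%O.
Proof.
move=> ij uj.
have le_u : (ones i.+1 <= u)%O.
  by apply: le_ones => k ki uk; apply: (triword_T3 u uk _ uj); lia.
rewrite lexI le_u /=; apply/meetsP => b bu.
apply/negPn/negP => Nb; have E := covers_join bu le_u Nb.
have bj : b j = 1 :> nat by move: uj; rewrite -E Hoch_joinE onesE; lia.
case/negP: Nb; apply: le_ones => k ki bk.
by apply: (triword_T3 b bk _ bj); lia.
Qed.

(** Each 2 of [u] drops in some lower cover, so the nucleus has letters at most 1. The last 1 of [u]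
    sits at some [l <= i] and drops to 0 in a lower cover; by (T3) the nucleus vanishes from [l]
    on. *)
Lemma nucleus_le_ones u i : ones_label u i -> (nucleus u <= ones i)%O.
Proof.
move=> /ones_labelP[le_i gt_i].
have /Hoch_leP le_u := nucleus_le u.
have le1 j : nucleus u j <= 1.
  have [uj|uj] := eqVneq (u j : nat) 2; last by have := le_u j; have := letter_lt3 u j; lia.
  case: (@lower_letter u j) => [| |w /nucleus_le_cover/Hoch_leP/(_ j)]; [lia|by left|lia].
(* The first letter of [u] is nonzero by [le_i] and not 2 by (T2), so [u] contains a 1. *)
pose o : 'I_n := Ordinal (leq_ltn_trans (leq0n i) (ltn_ord i)).
have uo : u o = 1 :> nat.
  have := le_i o (leq0n i); have := @triword_T2 _ u o erefl.
  by have := letter_lt3 u o; lia.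
have [l _ [ul /ones_labelP[_ gt_l]]] := last_one uo.
have nul : nucleus u l = 0 :> nat.
  case: (@lower_letter u l) => [| |w /nucleus_le_cover/Hoch_leP/(_ l)]; [lia|by right|lia].
have li : l <= i by rewrite leqNgt; apply/negP => /gt_i; rewrite ul.
apply/Hoch_leP => j; rewrite onesE; case: ltnP => ij; first exact: le1.
have [lj|lj] := eqVneq (l : nat) j; first by rewrite -(val_inj lj) nul.
have ltlj : l < j by move: lj => /=; lia.
by have := triword_T3 _ nul ltlj; have := le1 j; lia.
Qed.

Lemma core_labelsP u c :
  reflect ((exists2 i, u i = 2 :> nat & c = two i) \/
           (exists2 i, ones_label u i & c = ones i.+1))
          (c \in core_labels u).
Proof.
rewrite inE; apply: (iffP existsP) => [[w /existsP[w' /and4P[nuw cov w'u lab]]]|].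
- have /Hoch_leP le_u := w'u.
  have [/existsP[i /andP[/eqP wi' /eqP wi]]|N] :=
    boolP [exists i : 'I_n, (w' i == 2 :> nat) && (w i != 2 :> nat)].
    left; exists i; last exact: edge_label_uniq lab (edge_label_two cov wi wi').
    by have := le_u i; have := letter_lt3 u i; lia.
  (* No letter rises to 2 along this edge, so some letter rises from 0 to 1. *)
  have [ww' _] := andP cov.
  have : ~~ (w' <= w)%O by rewrite lt_geF.
  move=> /Hoch_leP/forallP; rewrite negb_forall => /existsP[i].
  rewrite -ltnNge => lti.
  move: N; rewrite negb_exists => /forallP/(_ i) Ni.
  have wi' : w' i = 1 :> nat by have := letter_lt3 w' i; lia.
  have wi : w i = 0 :> nat by lia.
  right; exists i; last exact: edge_label_uniq lab (edge_label_ones cov wi wi').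
  apply/ones_labelP; split=> j ij uj.
    have w'j : w' j = 0 :> nat by have := le_u j; lia.
    have [E|ne] := eqVneq (j : nat) i; first by rewrite (val_inj E) wi' in w'j.
    have ltji : j < i by move: ne => /=; lia.
    exact: (triword_T3 w' w'j ltji).
  (* A 1 of [u] after [i] would put [ones i.+1] below the nucleus, hence below [w], against
     [w i = 0]. *)
  have := le_trans (ones_le_nucleus ij uj) nuw.
  by move=> /Hoch_leP/(_ i); rewrite onesE ltnSn wi.
- case=> [[i ui ->]|[i Ai ->]].
    have [||w cov lti] := @lower_letter u i; [lia | by left | ].
    exists w; apply/existsP; exists u; rewrite cov lexx nucleus_le_cover //=.
    by apply: edge_label_two => //; lia.
  have [le_i _] := ones_labelP _ _ Ai.
  (* The edge from [ones i] to [ones i.+1] lies between the nucleus and [u] and carries the required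
     label. *)
  exists (ones i); apply/existsP; exists (ones i.+1).
  rewrite nucleus_le_ones // le_ones //=.
  have cov : covers (ones i) (ones i.+1).
    apply: (@covers_letter _ _ i); rewrite ?onesE ?ltnn ?ltnSn //; last by left.
    by move=> j; rewrite -val_eqE !onesE /=; lia.
  by rewrite cov edge_label_ones // onesE ?ltnn ?ltnSn.
Qed.

(** * Membership tests and injectivity *)

Lemma two_neq_ones u i m : u i = 2 :> nat -> two i <> ones m.
Proof.
by move=> ui E; have := two_diag ui; rewrite E onesE; case: (_ < _).
Qed.

Lemma two_core_label u i :
  0 < i -> (two i \in core_labels u) = (u i == 2 :> nat).
Proof.
move=> i0; have ii : two i i = 2 :> nat by rewrite twoE i0 eqxx.
apply/core_labelsP/eqP => [[[j uj E]|[j _ E]]|ui]; last by left; exists i.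
  by move: ii; rewrite E twoE; case: eqP => [->|]; rewrite ?andbF.
by move: ii; rewrite E onesE; case: (_ < _).
Qed.

Lemma ones_core_label u i : (ones i.+1 \in core_labels u) = ones_label u i.
Proof.
apply/core_labelsP/idP => [[[j uj E]|[j Aj E]]|Ai]; last by right; exists i.
  by case: (two_neq_ones uj (esym E)).
suff -> : i = j by [].
have Ei k : (k < i.+1) = (k < j.+1) :> nat by rewrite -!onesE E.
by apply: val_inj; have := Ei i; have := Ei j; rewrite /= !ltnSn; lia.
Qed.

Lemma core_labels_sub u v :
  (forall i, u i = 2 :> nat -> v i = 2 :> nat) ->
  (forall i, ones_label u i -> ones_label v i) ->
  core_labels u \subset core_labels v.
Proof.
move=> two_uv ones_uv; apply/subsetP => c /core_labelsP[[i ui ->]|[i Ai ->]].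
  by rewrite two_core_label ?(two_pos ui) //; apply/eqP/two_uv.
by rewrite ones_core_label; apply: ones_uv.
Qed.

(** A 2 at [i] is recorded by [two i]. A 1 at [i] is recorded by the label of the last 1 of [u],
    which sits at or after [i] and forces [v i] to be nonzero. *)
Lemma core_labels_inj : injective (@core_labels _ (Hoch n)).
Proof.
have aux u v i : core_labels u = core_labels v -> u i <= v i.
  move=> E; case ui: (nat_of_ord (u i)) => [//|[|m]].
    have [l il [_]] := last_one ui; rewrite -ones_core_label E ones_core_label.
    by move=> /ones_labelP[/(_ i il) + _]; lia.
  have ui2 : u i = 2 :> nat by have := letter_lt3 u i; lia.
  have := two_core_label u (two_pos ui2).
  rewrite E two_core_label ?(two_pos ui2) // ui2 => /eqP ->.
  by have := letter_lt3 u i; lia.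
by move=> u v E; apply: Hoch_eqP => i; apply/anti_leq; rewrite !aux.
Qed.

(** * Intersections of core label sets *)

Lemma core_labels_capP u v : exists w, core_labels w = core_labels u :&: core_labels v.
Proof.
pose A i := ones_label u i && ones_label v i.
pose both i := (u i == 2 :> nat) && (v i == 2 :> nat).
pose below i := [exists k : 'I_n, A k && (i <= k)].
(* Common 2s are kept; elsewhere the letter is 1 up to the last common [ones] label and 0 beyond
   it. *)
pose f i := if both i then 2 else below i : nat.
have below_le i j : i < j -> below j -> below i.
  move=> ij /existsP[k /andP[Ak jk]]; apply/existsP; exists k.
  by rewrite Ak (leq_trans (ltnW ij)).
have [||i j|w wE] := @triword_ext f.
- by move=> i; rewrite /f; case: ifP => // _; case: (below _).
- move=> i i0; rewrite /f /both.
  by case: eqP => [/triword_T2-/(_ i0)//|_]; case: (below _).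
- rewrite /f; case: ifP => // _; case bi: (below i) => // _ ij.
  case: ifP => // _; case bj: (below j) => //.
  by rewrite (below_le i j ij bj) in bi.
have w2 i : (w i == 2 :> nat) = both i.
  by rewrite wE /f; case: (both i); case: (below i).
have w_gt0 i : w i <> 0 :> nat -> both i \/ below i.
  by rewrite wE /f; case: (both i); case: (below i); [left|left|right|].
have wA i : ones_label w i = A i.
  apply/idP/idP => [/ones_labelP[le_i gt_i]|Ai].
    (* The first letter of [w] is nonzero and not 2, so it stems from a common [ones] label at some
       [k]. Without this [k], a 1 of [u] or [v] after [i] could not be excluded. *)
    pose o : 'I_n := Ordinal (leq_ltn_trans (leq0n i) (ltn_ord i)).
    have /existsP[k /andP[/andP[Auk Avk] _]] : below o.
      case: (w_gt0 o (le_i o (leq0n i))) => //.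
      by rewrite -w2 => /eqP /(triword_T2 w (i := o) erefl).
    have aux x : ones_label x k -> (forall j, A j -> ones_label x j) ->
        (forall j, both j -> x j = 2 :> nat) -> ones_label x i.
      move=> /ones_labelP[_ gt_k] sub_x both_x.
      apply/ones_labelP; split=> j ij xj.
        case: (w_gt0 j (le_i j ij)) => [/both_x|/existsP[h /andP[/sub_x]]]; first by rewrite xj.
        by move=> /ones_labelP[le_h _] /le_h.
      have jk : j <= k by rewrite leqNgt; apply/negP => /gt_k.
      have bj : below j by apply/existsP; exists k; rewrite /A Auk Avk.
      have Nb : both j = false by apply/negP => /both_x; rewrite xj.
      by apply: (gt_i j ij); rewrite wE /f Nb bj.
    apply/andP; split; apply: aux => // j.
    + by case/andP.
    + by case/andP => /eqP.
    + by case/andP.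
    + by case/andP => _ /eqP.
  (* A position after [i] but at or before another common label [k] has neither 0 nor 1 in [u] and
     [v], so both letters are 2 there and [w] has no 1. *)
  have [/ones_labelP[_ gtu] /ones_labelP[_ gtv]] := andP Ai.
  apply/ones_labelP; split=> j ij; rewrite wE /f.
    suff -> : below j by case: ifP.
    by apply/existsP; exists i; rewrite Ai.
  case: ifP => // Nb; case bj: (below j) => //.
  have /existsP[k /andP[/andP[/ones_labelP[leu _] /ones_labelP[lev _]] jk]] := bj.
  move: Nb; rewrite /both.
  have := gtu j ij; have := leu j jk; have := gtv j ij; have := lev j jk.
  have := letter_lt3 u j; have := letter_lt3 v j; lia.
exists w; apply/eqP; rewrite eqEsubset subsetI -andbA; apply/and3P; split.
- apply: core_labels_sub => i; first by move/eqP; rewrite w2 => /andP[/eqP].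
  by rewrite wA => /andP[].
- apply: core_labels_sub => i; first by move/eqP; rewrite w2 => /andP[_ /eqP].
  by rewrite wA => /andP[].
apply/subsetP => c; rewrite inE => /andP[/core_labelsP[[i ui ->]|[i Ai ->]]].
  by rewrite !two_core_label ?(two_pos ui) // w2 /both ui.
by rewrite !ones_core_label wA /A Ai.
Qed.

(** The top word is 1 followed by 2s: it has no 0, and its only 1 comes first, so every label
    occurs. *)
Lemma core_labels_top u : core_labels u \subset core_labels (\top%O : Hoch n).
Proof.
have topE i : (\top%O : Hoch n) i = (if i == 0 :> nat then 1 else 2) :> nat.
  by rewrite /= ffunE; case: eqP => //= _; rewrite inordK.
apply: core_labels_sub => i.
  by move=> /two_pos; rewrite topE; case: eqP => // ->.
move=> _; apply/ones_labelP; split=> j ij; rewrite topE; first by case: ifP.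
by rewrite gtn_eqF // (leq_ltn_trans _ ij).
Qed.

(** Iterates the binary case. Intersecting with the labels of the top starts the induction, since
    the empty intersection is the set of all words, which is no core label set. *)
Lemma core_labels_bigcapP (P : pred (Hoch n)) :
  exists w, forall c, (c \in core_labels w) =
    (c \in core_labels (\top%O : Hoch n)) && [forall (z | P z), c \in core_labels z].
Proof.
suff [w wE] : exists w, core_labels w =
    core_labels (\top%O : Hoch n) :&: \bigcap_(z | P z) core_labels z.
  exists w => c; rewrite wE inE; congr andb.
  by apply/bigcapP/forall_inP.
elim/big_rec: _ => [|z A _ [w wE]]; first by exists \top%O; rewrite setIT.
have [w' w'E] := core_labels_capP z w.
by exists w'; rewrite w'E wE setICA.
Qed.

Lemma core_label_le_poset : is_poset (@core_label_le _ (Hoch n)).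
Proof.
split=> [u|u v|v u w]; rewrite /core_label_le /=.
- exact: subxx.
- by rewrite -eqEsubset => /eqP; apply: core_labels_inj.
- exact: subset_trans.
Qed.

End HochschildCoreLabels.

Theorem theorem5p7 (n : nat) (n_gt0 : 0 < n) :
  is_lattice (@core_label_le _ (Hoch n)).
Proof.
split=> [|x y|x y]; first exact: core_label_le_poset.
  have [w wE] := core_labels_capP x y; exists w.
  split=> [||z /= zx zy]; rewrite /core_label_le /= wE ?subsetIl ?subsetIr //.
  by rewrite subsetI; apply/andP.
have [w wE] := core_labels_bigcapP (fun z => core_label_le x z && core_label_le y z).
exists w; split=> [||z xz yz]; apply/subsetP => c.
- move=> cx; rewrite wE (subsetP (core_labels_top x)) //=.
  by apply/forall_inP => z /andP[/subsetP + _]; apply.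
- move=> cy; rewrite wE (subsetP (core_labels_top y)) //=.
  by apply/forall_inP => z /andP[_ /subsetP]; apply.
- by rewrite wE => /andP[_ /forall_inP]; apply; rewrite xz yz.
Qed.
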